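(* Let $\rho\ge1$, $n\ge1$, $\alpha,\beta>-1$. (i) If $\alpha>\beta$ and $\alpha+\beta\ge-1$, then $\max_{z\in\mathcal{E}_\rho}|P_n^{(\alpha,\beta)}(z)|=P_n^{(\alpha,\beta)}\big(\tfrac12(\rho+\rho^{-1})\big)$, and the maximum is attained only at $z=\tfrac12(\rho+\rho^{-1})$. (ii) If $\alpha<\beta$ and $\alpha+\beta\ge-1$, then $\max_{z\in\mathcal{E}_\rho}|P_n^{(\alpha,\beta)}(z)|=\big|P_n^{(\alpha,\beta)}\big(-\tfrac12(\rho+\rho^{-1})\big)\big|$, and the maximum is attained only at $z=-\tfrac12(\rho+\rho^{-1})$. (iii) If $\alpha=\beta\ge-\tfrac12$, then $\max_{z\in\mathcal{E}_\rho}|P_n^{(\alpha,\beta)}(z)|=\big|P_n^{(\alpha,\beta)}\big(\pm\tfrac12(\rho+\rho^{-1})\big)\big|$ (attained at both endpoints of the major axis); if moreover $\alpha=\beta>-\tfrac12$, the maximum is attained only at these two points.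
   Context: $P_n^{(\alpha,\beta)}$ is the Jacobi polynomial $2^{-n}\sum_{k=0}^n\binom{n+\alpha}{n-k}\binom{n+\beta}{k}(x-1)^k(x+1)^{n-k}$. The Bernstein ellipse is $\mathcal{E}_\rho=\{\tfrac12(u+u^{-1}): u=\rho e^{i\theta},\ 0\le\theta<2\pi\}$ for $\rho\ge1$ (foci $\pm1$, semi-axes $\tfrac12(\rho\pm\rho^{-1})$). *)

(* Defs.v *)
From Stdlib Require Import Reals Arith.
Open Scope R_scope.

Definition C := (R * R)%type.
Definition RtoC (x : R) : C := (x, 0).
Definition Cadd (a b : C) : C := (fst a + fst b, snd a + snd b).
Definition Copp (a : C) : C := (- fst a, - snd a).
Definition Cmul (a b : C) : C :=
  (fst a * fst b - snd a * snd b, fst a * snd b + snd a * fst b).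
Definition Cinv (a : C) : C :=
  let d := fst a ^ 2 + snd a ^ 2 in (fst a / d, - snd a / d).
Definition Cmod (a : C) : R := sqrt (fst a ^ 2 + snd a ^ 2).
Fixpoint Cpow (a : C) (n : nat) : C :=
  match n with O => (1, 0) | S m => Cmul a (Cpow a m) end.
Fixpoint Csum (f : nat -> C) (n : nat) : C :=
  match n with O => f O | S m => Cadd (Csum f m) (f (S m)) end.

Fixpoint falling (a : R) (m : nat) : R :=
  match m with O => 1 | S k => falling a k * (a - INR k) end.
Definition gbinom (a : R) (m : nat) : R := falling a m / INR (Factorial.fact m).

Definition jacobiP (n : nat) (al be : R) (z : C) : C :=
  Cmul (RtoC (/ 2 ^ n))
    (Csum (fun k =>
       Cmul (RtoC (gbinom (INR n + al) (n - k) * gbinom (INR n + be) k))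
            (Cmul (Cpow (Cadd z (RtoC (-1))) k)
                  (Cpow (Cadd z (RtoC 1)) (n - k)))) n).

Definition bernstein_ellipse (rho : R) (z : C) : Prop :=
  exists theta : R,
    let u : C := (rho * cos theta, rho * sin theta) in
    z = Cmul (RtoC (/ 2)) (Cadd u (Cinv u)).

(* Main.v *)
Require Import Defs.
From Stdlib Require Import Reals Lra.
From mathcomp Require all_boot all_order all_algebra ring zify Rstruct complex.
Open Scope R_scope.

(** On the Bernstein ellipse write [z = (u + 1/u) / 2] with [|u| = rho]. Since
    [z - 1 = (u - 1)^2 / (2 u)] and [z + 1 = (u + 1)^2 / (2 u)], the Jacobi
    polynomial is [P (z) = Q (u) / (4 u)^n] for a polynomial [Q] of degree [2 n].
    With [d = al - be] and [s = al + be + 1], the Jacobi differential equation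
    becomes a three-term recurrence for the coefficients of [Q]:
      [j (2n - j + s) q_j = (2n + 2 - j) (j - 2 + s) q_(j-2) + 2 d (n + 1 - j) q_(j-1)].
    For [d, s >= 0] it yields [q_j >= 0] when [j <= n], and by its symmetry under
    [j |-> 2 n - j] for all [j]; hence [|Q (u)| <= Q (|u|)]. In case of equality
    all the terms [q_j u^j] are aligned: [q_0, q_1 > 0] (which holds when [d > 0])
    forces [u = rho], and [q_0, q_2 > 0] (when [s > 0]) forces [u = rho] or
    [u = - rho]. The case [al < be] follows from the reflection [z |-> - z]. *)

(** * Generalized binomial coefficients and the weights of the Jacobi sum *)

Lemma gbinomS a m : gbinom a (S m) * INR (S m) = gbinom a m * (a - INR m).
Proof.
unfold gbinom; rewrite fact_simpl, mult_INR; simpl falling.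
field; split; apply not_0_INR; [apply Factorial.fact_neq_0 | discriminate].
Qed.

Lemma gbinom_gt0 a m : INR m - 1 < a -> 0 < gbinom a m.
Proof.
intro am; apply Rdiv_lt_0_compat; [|apply INR_fact_lt_0].
induction m as [|m IH]; [simpl; lra|].
rewrite S_INR in am; simpl falling.
apply Rmult_lt_0_compat; [apply IH|]; lra.
Qed.

Definition jacobi_weight (n : nat) (al be : R) (k : nat) : R :=
  gbinom (INR n + al) (n - k) * gbinom (INR n + be) k.

Lemma jacobi_weight_gt0 n al be k :
  -1 < al -> -1 < be -> (k <= n)%nat -> 0 < jacobi_weight n al be k.
Proof.
intros hal hbe hk; pose proof (le_INR _ _ hk); pose proof (pos_INR k).
apply Rmult_lt_0_compat; apply gbinom_gt0; rewrite ?minus_INR by exact hk; lra.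
Qed.

(** Each side becomes the same product by applying [gbinomS] to one of its binomials. Taking
    [n = S (k + m)] replaces the truncated [n - k] and [n - S k] by [S m] and [m]. *)
Lemma jacobi_weightS m k al be :
  let n := (S (k + m))%nat in
  jacobi_weight n al be (S k) * (INR (S k) * (INR (S k) + al))
  = jacobi_weight n al be k * (INR (S m) * (INR (S m) + be)).
Proof.
intro n; unfold jacobi_weight.
replace (n - S k)%nat with m by (unfold n; simpl; rewrite Nat.add_comm, Nat.add_sub; reflexivity).
replace (n - k)%nat with (S m)
  by (unfold n; rewrite <- Nat.add_succ_r, Nat.add_comm, Nat.add_sub; reflexivity).
pose proof (gbinomS (INR n + al) m) as e1.
pose proof (gbinomS (INR n + be) k) as e2.
replace (INR n + al - INR m) with (INR (S k) + al) in e1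
  by (unfold n; rewrite !S_INR, plus_INR; ring).
replace (INR n + be - INR k) with (INR (S m) + be) in e2
  by (unfold n; rewrite !S_INR, plus_INR; ring).
transitivity (gbinom (INR n + al) m * (INR (S k) + al)
  * (gbinom (INR n + be) (S k) * INR (S k))); [ring|].
rewrite e2, <- e1; ring.
Qed.

(** * Polar form and central symmetry of the ellipse *)

Lemma Cmod_polar rho theta :
  0 < rho -> Cmod (rho * cos theta, rho * sin theta) = rho.
Proof.
intro h; unfold Cmod; simpl fst; simpl snd.
replace ((rho * cos theta) ^ 2 + (rho * sin theta) ^ 2) with (rho * rho).
  apply sqrt_square; lra.
rewrite <- (Rmult_1_r (rho * rho)), <- (sin2_cos2 theta); unfold Rsqr; ring.
Qed.

Lemma CoppK z : Copp (Copp z) = z.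
Proof. destruct z; unfold Copp; simpl; rewrite !Ropp_involutive; reflexivity. Qed.

Lemma Copp_RtoC x : Copp (RtoC x) = RtoC (- x).
Proof. unfold Copp, RtoC; simpl; rewrite Ropp_0; reflexivity. Qed.

Lemma bernstein_ellipse_opp rho z :
  bernstein_ellipse rho z -> bernstein_ellipse rho (Copp z).
Proof.
intros [theta e]; exists (theta + PI); rewrite e, neg_cos, neg_sin.
unfold Copp, Cmul, Cadd, Cinv, RtoC; cbn [fst snd].
replace ((rho * - cos theta) ^ 2 + (rho * - sin theta) ^ 2)
  with ((rho * cos theta) ^ 2 + (rho * sin theta) ^ 2) by ring.
f_equal; unfold Rdiv; ring.
Qed.

Module Ellipse.
Import mathcomp.boot.all_boot mathcomp.order.all_order mathcomp.algebra.all_algebra.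
Import mathcomp.algebra_tactics.ring mathcomp.zify.zify.
Import mathcomp.reals_stdlib.Rstruct mathcomp.real_closed.complex.
Import Order.TTheory GRing.Theory Num.Theory.
Set Implicit Arguments. Unset Strict Implicit. Unset Printing Implicit Defensive.
Local Open Scope ring_scope.

(** * The Jacobi differential operator on polynomials in [u] *)

Section JacobiOperator.
Variable F : comNzRingType.
Implicit Types (p q : {poly F}) (b : nat -> F).

(** The operator [u d/du]. It is diagonal on monomials, so an equation written with it turns into a
    recurrence on coefficients. *)
Definition euler p : {poly F} := 'X * p^`().

Lemma coef_euler p i : (euler p)`_i = i%:R * p`_i.
Proof.
by rewrite /euler coefXM coef_deriv; case: i => [|i] /=; rewrite ?mul0r ?mulr_natl.
Qed.

Lemma eulerM p q : euler (p * q) = euler p * q + p * euler q.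
Proof. rewrite /euler derivM; ring. Qed.

Lemma eulerD p q : euler (p + q) = euler p + euler q.
Proof. by rewrite /euler derivD mulrDr. Qed.

Lemma eulerZ c p : euler (c *: p) = c *: euler p.
Proof. by rewrite /euler derivZ scalerAr. Qed.

(** The extra factor [w] restores the exponent [k] lost by differentiation, so that no [k - 1]
    appears. *)
Lemma mul_euler_exp (w : {poly F}) k :
  w^`() = 1 -> w * euler (w ^+ k) = k%:R * 'X * w ^+ k.
Proof.
move=> dw; rewrite /euler deriv_exp dw; case: k => [|k] /=.
  by rewrite mulr0n !mulr0 !mul0r.
by rewrite mul1r -mulr_natl exprS; ring.
Qed.

(** Apply [euler] to the first-order equation, which characterizes [W] as a power [w ^ K], then
    multiply by [w] and use that equation again. *)
Lemma mul_euler2 (w W : {poly F}) (K : F) :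
  w^`() = 1 -> w * euler W = K%:P * 'X * W ->
  w ^+ 2 * euler (euler W) = K%:P * 'X * W * (w + (K%:P - 1) * 'X).
Proof.
move=> dw e.
have ew : euler w = 'X by rewrite /euler dw mulr1.
have eX : euler 'X = 'X by rewrite /euler derivX mulr1.
have eK : euler K%:P = 0 by rewrite /euler derivC mulr0.
have := congr1 euler e.
rewrite (eulerM w (euler W)) (eulerM _ W) (eulerM K%:P 'X) ew eX eK mul0r add0r => e2.
have e3 : w * euler (euler W)
   = K%:P * 'X * W + K%:P * 'X * euler W - 'X * euler W.
  by rewrite -e2; ring.
transitivity (w * (w * euler (euler W))); first by ring.
rewrite e3; transitivity (K%:P * 'X * W * w + (K%:P - 1) * 'X * (w * euler W)).
  by ring.
by rewrite e; ring.
Qed.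

(* The Jacobi operator in the variable [u], where [x = (u + 1/u) / 2], after
   conjugation by [u ^ n]; [d] and [s] stand for [al - be] and [al + be + 1]. *)
Definition jacobi_op (n : nat) (d s : F) p : {poly F} :=
  ('X^2 - 1) * (euler (euler p) - (n.*2%:R)%:P * euler p - (n%:R * s)%:P * p)
  + ((2 * d)%:P * 'X + s%:P * ('X^2 + 1)) * (euler p - (n%:R)%:P * p).

Lemma jacobi_opD n d s p q :
  jacobi_op n d s (p + q) = jacobi_op n d s p + jacobi_op n d s q.
Proof. rewrite /jacobi_op (eulerD p q) (eulerD (euler p)); ring. Qed.

Lemma jacobi_opZ n d s c p : jacobi_op n d s (c *: p) = c *: jacobi_op n d s p.
Proof. rewrite /jacobi_op (eulerZ c p) (eulerZ c (euler p)) -!mul_polyC; ring. Qed.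

Lemma jacobi_op0 n d s : jacobi_op n d s 0 = 0.
Proof. by have := jacobi_opZ n d s 0 0; rewrite !scale0r. Qed.

Definition jacobi_term (k m : nat) : {poly F} :=
  ('X - 1) ^+ k.*2 * ('X + 1) ^+ m.*2.

(* The factor [('X - 1)^2 * ('X + 1)^2] avoids truncated exponents in the derivatives. *)
Lemma jacobi_op_term_aux (k m : nat) (al be : F) :
  (('X - 1) * ('X + 1)) ^+ 2
    * jacobi_op (k + m) (al - be) (al + be + 1) (jacobi_term k m)
  = 4 * 'X * ('X ^+2 - 1) *
    ((k%:R * (k%:R + al))%:P * ('X + 1) ^+ 2
     - (m%:R * (m%:R + be))%:P * ('X - 1) ^+ 2) * jacobi_term k m.
Proof.
have dw : ('X - 1 : {poly F})^`() = 1 by rewrite derivB derivX derivC subr0.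
have dv : ('X + 1 : {poly F})^`() = 1 by rewrite derivD derivX derivC addr0.
have natP j : j%:R = (j%:R)%:P :> {poly F} by rewrite polyC_natr.
have ew := mul_euler_exp k.*2 dw; rewrite natP in ew.
have ev := mul_euler_exp m.*2 dv; rewrite natP in ev.
have ew2 := mul_euler2 dw ew; have ev2 := mul_euler2 dv ev.
rewrite /jacobi_op /jacobi_term.
set W := ('X - 1) ^+ k.*2 in ew ew2 *; set V := ('X + 1) ^+ m.*2 in ev ev2 *.
rewrite (eulerM W V) eulerD (eulerM (euler W) V) (eulerM W (euler V)).
move: (euler (euler W)) (euler (euler V)) ew2 ev2 => W2 V2 ew2 ev2.
move: (euler W) (euler V) ew ew2 ev ev2 => W1 V1.
rewrite -!addnn; move: W V => W V ew ew2 ev ev2.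
(* With [W], [V] and their derivatives generalized, only [ew], [ew2], [ev], [ev2] relate them. This
   regrouping makes the left-hand sides of these relations appear literally. *)
transitivity (('X^2 - 1) *
  (('X - 1) ^+ 2 * W2 * ('X + 1) ^+ 2 * V
   + 2 * (('X - 1) * W1) * (('X + 1) * V1) * ('X^2 - 1)
   + ('X - 1) ^+ 2 * W * (('X + 1) ^+ 2 * V2)
   - ((k + m + (k + m))%:R)%:P * ('X^2 - 1)
       * (('X - 1) * W1 * ('X + 1) * V + ('X - 1) * W * (('X + 1) * V1))
   - ((k + m)%:R * (al + be + 1))%:P * ('X^2 - 1) ^+ 2 * (W * V))
  + ((2 * (al - be))%:P * 'X + (al + be + 1)%:P * ('X^2 + 1)) *
  (('X^2 - 1) * (('X - 1) * W1 * ('X + 1) * V + ('X - 1) * W * (('X + 1) * V1))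
   - ((k + m)%:R)%:P * ('X^2 - 1) ^+ 2 * (W * V))).
  by ring.
by rewrite ew ew2 ev ev2; ring.
Qed.
End JacobiOperator.

(** * The differential equation and the coefficient recurrence *)

Section JacobiPolynomial.
Variable F : idomainType.
Implicit Types (p q : {poly F}) (b : nat -> F).

(** Cancel the nonzero square in [jacobi_op_term_aux], which requires an integral domain. The
    default [0.-1 = 0] is harmless, since it comes with the factor [k = 0] or [m = 0]. *)
Lemma jacobi_op_term n k m (al be : F) : (k + m)%N = n ->
  jacobi_op n (al - be) (al + be + 1) (jacobi_term F k m)
  = 4 * 'X * ('X^2 - 1) *
    ((k%:R * (k%:R + al)) *: jacobi_term F k.-1 m
     - (m%:R * (m%:R + be)) *: jacobi_term F k m.-1).
Proof.
move=> <-; have nz : (('X - 1) * ('X + 1)) ^+ 2 != 0 :> {poly F}.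
  by rewrite expf_neq0 // mulf_neq0 // monic_neq0 // ?monicXsubC ?monicXaddC.
apply: (mulfI nz); rewrite jacobi_op_term_aux -!mul_polyC.
rewrite -mulrA mulrBl.
have -> : (k%:R * (k%:R + al))%:P * ('X + 1) ^+ 2 * jacobi_term F k m
  = (('X - 1) * ('X + 1)) ^+ 2 * ((k%:R * (k%:R + al))%:P * jacobi_term F k.-1 m) :> {poly F}.
  rewrite /jacobi_term; case: k => [|k] /=; first by rewrite mul0r polyC0; ring.
  by rewrite doubleS !exprS; ring.
have -> : (m%:R * (m%:R + be))%:P * ('X - 1) ^+ 2 * jacobi_term F k m
  = (('X - 1) * ('X + 1)) ^+ 2 * ((m%:R * (m%:R + be))%:P * jacobi_term F k m.-1) :> {poly F}.
  rewrite /jacobi_term; case: m => [|m] /=; first by rewrite mul0r polyC0; ring.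
  by rewrite doubleS !exprS; ring.
by ring.
Qed.

(** Up to the factor [2 ^ n], the numerator of the Jacobi polynomial at [(u + 1/u) / 2] over
    [(4 u) ^ n]. *)
Definition jacobi_poly n b : {poly F} :=
  \sum_(k < n.+1) b k *: jacobi_term F k (n - k).

(* The relation between consecutive weights [binom (n + al) (n - k) * binom (n + be) k]. *)
Definition jacobi_weight_rel n (al be : F) b : Prop :=
  forall k, (k < n)%N ->
  b k.+1 * (k.+1%:R * (k.+1%:R + al)) = b k * ((n - k)%:R * ((n - k)%:R + be)).

(* By [jacobi_op_term] and the relation between the weights, the sum telescopes. *)
Lemma jacobi_op_poly n al be b : jacobi_weight_rel n al be b ->
  jacobi_op n (al - be) (al + be + 1) (jacobi_poly n b) = 0.
Proof.
move=> hb; rewrite /jacobi_poly.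
rewrite (big_morph (jacobi_op n (al - be) (al + be + 1))
  (jacobi_opD n (al - be) (al + be + 1)) (jacobi_op0 n (al - be) (al + be + 1))).
under eq_bigr => k _.
  rewrite jacobi_opZ.
  rewrite (jacobi_op_term _ _ (subnKC (leq_ord k))) scalerAr scalerBr !scalerA.
  over.
(* The term [k = 0] of the first sum and the term [k = n] of the second vanish; what remains cancels
   in pairs after a shift by one. *)
rewrite -mulr_sumr sumrB big_ord_recl big_ord_recr /= subnn !mul0r !mulr0 !scale0r.
rewrite add0r addr0 -sumrB big1 ?mulr0 // => i _.
rewrite /bump /= add1n hb // subnS subrr //.
Qed.

(** Compare coefficients of degree [j + 2] and of degree [1] in the differential equation. The
    second relation is the case [j = -1] with [q_(-1) = 0]. *)
Lemma jacobi_poly_rec n al be b : jacobi_weight_rel n al be b ->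
  let d := al - be in let s := al + be + 1 in let q := jacobi_poly n b in
  (forall j, j.+2%:R * ((n.*2)%:R - j.+2%:R + s) * q`_j.+2
    = ((n.*2)%:R - j%:R) * (j%:R + s) * q`_j
      + 2 * d * (n%:R - j.+1%:R) * q`_j.+1)
  /\ ((n.*2)%:R - 1 + s) * q`_1 = 2 * d * n%:R * q`_0.
Proof.
move=> /jacobi_op_poly h d s q.
have hp i := congr1 (fun p : {poly F} => p`_i) h.
have E p : jacobi_op n d s p =
  'X^2 * (euler (euler p) - (n.*2%:R)%:P * euler p - (n%:R * s)%:P * p)
  - (euler (euler p) - (n.*2%:R)%:P * euler p - (n%:R * s)%:P * p)
  + (2 * d) *: ('X * (euler p - (n%:R)%:P * p))
  + s *: ('X^2 * (euler p - (n%:R)%:P * p))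
  + s *: (euler p - (n%:R)%:P * p).
  by rewrite /jacobi_op -!mul_polyC; ring.
have coef_ops := (coef_euler, coefD, coefN, coefZ, coefXnM, coefXM, coefCM).
split=> [j|].
  have := hp j.+2; rewrite -/d -/s -/q E // coef0 !coef_ops /=.
  by rewrite !subSS subn0 -!addnn => e; apply: subr0_eq; rewrite -[RHS]e; ring.
have := hp 1%N; rewrite -/d -/s -/q E // coef0 !coef_ops /=.
move=> e; apply: subr0_eq; rewrite -[RHS]e; ring.
Qed.
End JacobiPolynomial.

(** * Sign of the solutions of the recurrence *)

Section Positivity.
Variables (F : numDomainType) (n : nat) (d s : F) (c : nat -> F).
Hypotheses (n_gt0 : (0 < n)%N) (d_ge0 : 0 <= d) (s_ge0 : 0 <= s) (c0_gt0 : 0 < c 0).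
Hypothesis c1E : ((n.*2)%:R - 1 + s) * c 1 = 2 * d * n%:R * c 0.
Hypothesis c_rec : forall j, (j.+2 <= n.*2)%N ->
  j.+2%:R * ((n.*2)%:R - j.+2%:R + s) * c j.+2
    = ((n.*2)%:R - j%:R) * (j%:R + s) * c j + 2 * d * (n%:R - j.+1%:R) * c j.+1.

(** Two-step induction: while [j + 2 <= n], the factors on the right of [c_rec] are nonnegative and
    the one on the left is positive. The sequence [c] is abstract so as to cover the coefficients
    and their reversal alike. *)
Lemma rec_ge0 j : (j <= n)%N -> 0 <= c j.
Proof.
have den_gt0 i : (0 < i <= n)%N -> 0 < (n.*2)%:R - i%:R + s.
  move=> ilen; rewrite ltr_wpDr // subr_gt0 ltr_nat; lia.
suff: ((j <= n)%N -> 0 <= c j) /\ ((j.+1 <= n)%N -> 0 <= c j.+1) by case.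
elim: j => [|j [IH0 IH1]]; split=> //.
- by move=> _; exact: ltW.
-
  move=> _; have := den_gt0 1%N; rewrite n_gt0 => /(_ isT) /pmulr_rge0 <-.
  by rewrite c1E !mulr_ge0 ?ler0n // ltW.
move=> jn; have den : 0 < j.+2%:R * ((n.*2)%:R - j.+2%:R + s) by rewrite mulr_gt0 ?den_gt0.
rewrite -(pmulr_rge0 _ den) c_rec; last by lia.
have c_j : 0 <= c j by apply: IH0; lia.
have c_j1 : 0 <= c j.+1 by apply: IH1; lia.
have ge2 : 0 <= (n.*2)%:R - j%:R :> F by rewrite subr_ge0 ler_nat; lia.
have ge1 : 0 <= n%:R - j.+1%:R :> F by rewrite subr_ge0 ler_nat; lia.
have ge0 : 0 <= j%:R + s by rewrite addr_ge0.
by rewrite addr_ge0 // !mulr_ge0.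
Qed.

Lemma rec_gt0_1 : 0 < d -> 0 < c 1.
Proof.
move=> d_gt0; have den : 0 < (n.*2)%:R - 1 + s.
  rewrite ltr_wpDr // subr_gt0 ltr1n; lia.
by rewrite -(pmulr_rgt0 _ den) c1E !mulr_gt0 // ltr0n.
Qed.

Lemma rec_gt0_2 : 0 < s -> 0 < c 2.
Proof.
(* For [n = 1] this factor is [2 s], so its positivity rests on [s > 0]. *)
move=> s_gt0; have den : 0 < 2%:R * ((n.*2)%:R - 2%:R + s).
  rewrite mulr_gt0 ?ltr0n // ltr_wpDl // subr_ge0 ler_nat; lia.
rewrite -(pmulr_rgt0 _ den) c_rec; last by lia.
rewrite ltr_pwDl ?mulr_gt0 ?subr0 ?add0r ?ltr0n ?double_gt0 //.
by rewrite !mulr_ge0 ?subr_ge0 ?ler1n ?rec_ge0 ?ler0n.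
Qed.
End Positivity.

(** * Nonnegativity of the coefficients of [jacobi_poly] *)

Section JacobiCoefficients.
Variables (F : numClosedFieldType) (n : nat) (al be : F) (b : nat -> F).
Hypotheses (n_gt0 : (0 < n)%N) (al_ge_be : be <= al) (al_be : -1 <= al + be).
Hypothesis b_gt0 : forall k, (k <= n)%N -> 0 < b k.
Hypothesis hb : jacobi_weight_rel n al be b.

Let d := al - be.
Let s := al + be + 1.
Let q := jacobi_poly n b.

Lemma jacobi_term_monic k m : jacobi_term F k m \is monic.
Proof. by rewrite monicMl monic_exp // ?monicXsubC ?monicXaddC. Qed.

Lemma size_jacobi_term k m : size (jacobi_term F k m) = (k + m).*2.+1.
Proof.
rewrite /jacobi_term size_Mmonic ?monic_exp ?monicXaddC //; last first.
  by rewrite monic_neq0 // monic_exp ?monicXsubC.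
have eX : 'X + 1 = 'X - (-1)%:P :> {poly F} by rewrite polyCN opprK.
rewrite eX -polyC1 !size_exp_XsubC; lia.
Qed.

Lemma sum_b_gt0 : 0 < \sum_(k < n.+1) b k.
Proof.
rewrite big_ord_recl ltr_pwDl ?b_gt0 ?sumr_ge0 // => i _.
by rewrite ltW // b_gt0 //= -ltnS ltn_ord.
Qed.

(** Even exponents make every [jacobi_term] equal to [1] at [u = 0]. *)
Lemma jacobi_poly_coef0 : q`_0 = \sum_(k < n.+1) b k.
Proof.
rewrite coef_sum; apply: eq_bigr => k _.
rewrite coefZ -horner_coef0 /jacobi_term !hornerE -!mul2n !exprM ?sub0r ?add0r.
by rewrite sqrrN !expr1n /= !mulr1.
Qed.

Lemma jacobi_poly_coef_top : q`_(n.*2) = \sum_(k < n.+1) b k.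
Proof.
rewrite coef_sum; apply: eq_bigr => k _; rewrite coefZ.
have /monicP := jacobi_term_monic k (n - k).
by rewrite lead_coefE size_jacobi_term subnKC ?leq_ord //= => ->; rewrite mulr1.
Qed.

Lemma size_jacobi_poly : (size q <= n.*2.+1)%N.
Proof.
apply: (leq_trans (size_sum _ _ _)); apply/bigmax_leqP => k _.
by rewrite (leq_trans (size_scale_leq _ _)) // size_jacobi_term subnKC ?leq_ord.
Qed.

Let d_ge0 : 0 <= d. Proof. by rewrite subr_ge0. Qed.
Let s_ge0 : 0 <= s. Proof. by rewrite -lerBlDr sub0r. Qed.

(* The recurrence is invariant under [j |-> 2 n - j], so it bounds the upper
   half of the coefficients as well. *)
Lemma jacobi_poly_coef_ge0 j : 0 <= q`_j.
Proof.
have [rec rec1] := jacobi_poly_rec hb; rewrite -/d -/s -/q in rec rec1.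
have q_gt0 := sum_b_gt0.
have [jn|nj] := leqP j n.
  apply: (@rec_ge0 F n d s (fun j => q`_j)) => //; first by rewrite jacobi_poly_coef0.
have [j2n|?] := leqP j n.*2; last first.
  by rewrite nth_default // (leq_trans size_jacobi_poly).
have -> : j = (n.*2 - (n.*2 - j))%N by lia.
apply: (@rec_ge0 F n d s (fun j => q`_(n.*2 - j))) => //.
- by rewrite subn0 jacobi_poly_coef_top.
(* At [j = 2 n - 1] the coefficient of index [2 n + 1] is beyond the degree; its vanishing leaves
   the initial relation of the reversed sequence. *)
- rewrite subn0; have := rec (n.*2 - 1)%N.
  have -> : (n.*2 - 1).+2 = n.*2.+1 by lia.
  have -> : (n.*2 - 1).+1 = n.*2 by lia.
  rewrite [q`_ n.*2.+1]nth_default ?size_jacobi_poly // mulr0 natrB; last by lia.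
  move=> e; apply: subr0_eq; rewrite [RHS]e -!addnn; ring.
- move=> i hi; have := rec (n.*2 - i.+2)%N.
  have -> : (n.*2 - i.+2).+2 = (n.*2 - i)%N by lia.
  have -> : (n.*2 - i.+2).+1 = (n.*2 - i.+1)%N by lia.
  rewrite !natrB; try lia.
  move=> e; apply: subr0_eq; move/eqP: e; rewrite -subr_eq0 => /eqP e.
  apply: oppr_inj; rewrite oppr0 -[RHS]e -!addnn; ring.
- lia.
Qed.

Lemma jacobi_poly_coef0_gt0 : 0 < q`_0.
Proof. by rewrite jacobi_poly_coef0 sum_b_gt0. Qed.

Lemma jacobi_poly_coef1_gt0 : be < al -> 0 < q`_1.
Proof.
have [rec rec1] := jacobi_poly_rec hb; rewrite -subr_gt0 => dgt0.
apply: (@rec_gt0_1 F n d s (fun j => q`_j)) => //.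
exact: jacobi_poly_coef0_gt0.
Qed.

Lemma jacobi_poly_coef2_gt0 : -1 < al + be -> 0 < q`_2.
Proof.
have [rec rec1] := jacobi_poly_rec hb; rewrite -subr_gt0 opprK => sgt0.
apply: (@rec_gt0_2 F n d s (fun j => q`_j)) => //.
exact: jacobi_poly_coef0_gt0.
Qed.
End JacobiCoefficients.

(** * Polynomials with nonnegative coefficients on a circle *)

Section NonnegativePolynomial.
Variables (F : numClosedFieldType) (q : {poly F}).
Hypothesis q_ge0 : forall j, 0 <= q`_j.

Lemma ler_norm_horner u : `|q.[u]| <= q.[`|u|].
Proof.
rewrite !horner_coef (le_trans (ler_norm_sum _ _ _)) // ler_sum // => i _.
by rewrite normrM normrX ger0_norm.
Qed.

(** Equality in the triangle inequality gives all terms [q_i u^i] a common direction [t]. The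
    constant term forces [t = 1], and the term of index [k] then gives the claim. *)
Lemma norm_horner_eq u k : 0 < q`_0 -> 0 < q`_k -> `|q.[u]| = q.[`|u|] ->
  u ^+ k = `|u| ^+ k.
Proof.
move=> q0 qk; rewrite !horner_coef.
have nrm : \sum_(i < size q) q`_i * `|u| ^+ i = \sum_(i < size q) `|q`_i * u ^+ i|.
  by apply: eq_bigr => i _; rewrite normrM normrX ger0_norm.
have lt_size j : 0 < q`_j -> (j < size q)%N.
  by move=> qj; rewrite ltnNge; apply/negP => /(nth_default 0) e; rewrite e ltxx in qj.
rewrite nrm => /normC_sum_eq [t _ h].
have := h (Ordinal (lt_size _ q0)) isT; have := h (Ordinal (lt_size _ qk)) isT.
rewrite /= !expr0 !mulr1 !normrM normrX !(ger0_norm (q_ge0 _)) => hk h0.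
have t1 : t = 1 by apply: (mulfI (lt0r_neq0 q0)); rewrite -h0 mulr1.
by move: hk; rewrite t1 mulr1 => /(mulfI (lt0r_neq0 qk)).
Qed.
End NonnegativePolynomial.

(** * Jacobi sums composed with the Joukowski map *)

Section JacobiSum.
Variable F : numClosedFieldType.
Implicit Types (b : nat -> F) (u z : F).

Definition jacobi_sum n b z : F :=
  \sum_(k < n.+1) b k * ((z - 1) ^+ k * (z + 1) ^+ (n - k)).

Definition joukowski u : F := (u + u^-1) / 2.

Lemma jacobi_sum_joukowski n b u : u != 0 ->
  jacobi_sum n b (joukowski u) = (jacobi_poly n b).[u] / (2 * u) ^+ n.
Proof.
move=> u0; rewrite horner_sum mulr_suml; apply: eq_bigr => k _.
have -> : joukowski u - 1 = (u - 1) ^+ 2 / (2 * u) by rewrite /joukowski; field.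
have -> : joukowski u + 1 = (u + 1) ^+ 2 / (2 * u) by rewrite /joukowski; field.
rewrite hornerZ /jacobi_term hornerM !horner_exp hornerD hornerN hornerX hornerC.
rewrite hornerD hornerX hornerC !expr_div_n -!exprM -!mul2n.
have -> : (2 * u) ^+ n = (2 * u) ^+ k * (2 * u) ^+ (n - k).
  by rewrite -exprD subnKC ?leq_ord.
field; rewrite !expf_neq0 ?mulf_neq0 ?pnatr_eq0 //.
Qed.

(** Negating [z] exchanges [z - 1] and [z + 1] up to sign; reversing the summation moves the
    exchange onto the weights. *)
Lemma jacobi_sumN n b z :
  jacobi_sum n b (- z) = (-1) ^+ n * jacobi_sum n (fun k => b (n - k)%N) z.
Proof.
rewrite /jacobi_sum (reindex_inj rev_ord_inj) mulr_sumr; apply: eq_bigr => k _ /=.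
have kn : (k <= n)%N := leq_ord k.
rewrite subSS subKn //.
have -> : - z - 1 = - (z + 1) by ring.
have -> : - z + 1 = - (z - 1) by ring.
have -> : (-1) ^+ n = (-1) ^+ k * (-1) ^+ (n - k) :> F by rewrite -exprD subnKC.
rewrite (exprNn (z + 1)) (exprNn (z - 1)); ring.
Qed.

Section Bound.
Variables (n : nat) (al be : F) (b : nat -> F).
Hypotheses (n_gt0 : (0 < n)%N) (al_ge_be : be <= al) (al_be : -1 <= al + be).
Hypothesis b_gt0 : forall k, (k <= n)%N -> 0 < b k.
Hypothesis hb : jacobi_weight_rel n al be b.

Let q_ge0 := jacobi_poly_coef_ge0 n_gt0 al_ge_be al_be b_gt0 hb.

Lemma norm_jacobi_sum u : u != 0 ->
  `|jacobi_sum n b (joukowski u)| = `|(jacobi_poly n b).[u]| / (2 * `|u|) ^+ n.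
Proof.
by move=> u0; rewrite jacobi_sum_joukowski // normf_div normrX normrM normr_nat.
Qed.

Lemma jacobi_sum_ge0 u : u != 0 -> 0 <= jacobi_sum n b (joukowski `|u|).
Proof.
move=> u0; rewrite jacobi_sum_joukowski ?normr_eq0 //.
rewrite mulr_ge0 ?invr_ge0 ?exprn_ge0 ?mulr_ge0 ?ler0n //.
by rewrite (le_trans _ (ler_norm_horner q_ge0 u)).
Qed.

Lemma norm_jacobi_sum_le u : u != 0 ->
  `|jacobi_sum n b (joukowski u)| <= jacobi_sum n b (joukowski `|u|).
Proof.
move=> u0; rewrite norm_jacobi_sum // jacobi_sum_joukowski ?normr_eq0 //.
rewrite ler_pM2r ?ler_norm_horner // invr_gt0 exprn_gt0 // mulr_gt0 ?ltr0n //.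
by rewrite normr_gt0.
Qed.

Lemma norm_jacobi_sum_eq u k : u != 0 -> 0 < (jacobi_poly n b)`_k ->
  `|jacobi_sum n b (joukowski u)| = jacobi_sum n b (joukowski `|u|) ->
  u ^+ k = `|u| ^+ k.
Proof.
move=> u0 qk; rewrite norm_jacobi_sum // jacobi_sum_joukowski ?normr_eq0 //.
have nz : (2 * `|u|) ^+ n != 0.
  by rewrite expf_neq0 // mulf_neq0 ?pnatr_eq0 // normr_eq0.
move=> /(divIf nz); apply: norm_horner_eq => //.
exact: jacobi_poly_coef0_gt0 b_gt0.
Qed.

Lemma norm_jacobi_sum_eq1 u : be < al -> u != 0 ->
  `|jacobi_sum n b (joukowski u)| = jacobi_sum n b (joukowski `|u|) -> u = `|u|.
Proof.
move=> lt u0 /(norm_jacobi_sum_eq (k := 1) u0); apply.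
exact: jacobi_poly_coef1_gt0 lt.
Qed.

Lemma norm_jacobi_sum_eq2 u : -1 < al + be -> u != 0 ->
  `|jacobi_sum n b (joukowski u)| = jacobi_sum n b (joukowski `|u|) ->
  u = `|u| \/ u = - `|u|.
Proof.
move=> lt u0 /(norm_jacobi_sum_eq (k := 2) u0) e.
have /e/eqP : 0 < (jacobi_poly n b)`_2 by apply: jacobi_poly_coef2_gt0 lt.
by rewrite eqf_sqr => /orP[] /eqP; [left|right].
Qed.
End Bound.
End JacobiSum.

(** * Transfer between pairs of reals and the closed field [CC] *)

Definition CC : numClosedFieldType := complex R.

(** Parameters and weights are embedded too: the partial order of [CC] restricts to the usual order
    on reals, so their inequalities can be stated in the field that contains [u]. *)
Definition ofR (x : R) : CC := x%:C%C.
Definition ofC (z : Defs.C) : CC := (z.1 +i* z.2)%C.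

Lemma ofC_inj : injective ofC.
Proof. by move=> [a b] [c d] [-> ->]. Qed.

Lemma ofCD z w : ofC (Cadd z w) = ofC z + ofC w.
Proof. by []. Qed.

Lemma ofCM z w : ofC (Cmul z w) = ofC z * ofC w.
Proof. by []. Qed.

Lemma ofC_real x : ofC (RtoC x) = ofR x.
Proof. by []. Qed.

Lemma ofCX z n : ofC (Cpow z n) = ofC z ^+ n.
Proof. by elim: n => [|n IH] //; rewrite exprS -IH. Qed.

Lemma ofC_sum f n : ofC (Csum f n) = \sum_(k < n.+1) ofC (f k).
Proof.
elim: n => [|n IH]; first by rewrite big_ord_recr big_ord0 /= add0r.
by rewrite big_ord_recr /= -IH.
Qed.

Lemma ofCV z : ofC (Cinv z) = (ofC z)^-1.
Proof.
case: z => a b; rewrite /Cinv /ofC !RdivE !RpowE; congr (_ +i* _)%C.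
exact: mulNr.
Qed.

Lemma norm_ofC z : `|ofC z| = ofR (Cmod z).
Proof. rewrite /Cmod RsqrtE !RpowE; exact: normc_def. Qed.

Lemma ofRD x y : ofR (Rplus x y) = ofR x + ofR y.
Proof. exact: (rmorphD (real_complex R)). Qed.

Lemma ofRN x : ofR (Ropp x) = - ofR x.
Proof. exact: (rmorphN (real_complex R)). Qed.

Lemma ofRM x y : ofR (Rmult x y) = ofR x * ofR y.
Proof. exact: (rmorphM (real_complex R)). Qed.

Lemma ofRV x : ofR (Rinv x) = (ofR x)^-1.
Proof. rewrite RinvE; exact: (fmorphV (real_complex R)). Qed.

Lemma ofRX x n : ofR (pow x n) = ofR x ^+ n.
Proof. rewrite RpowE; exact: (rmorphXn (real_complex R)). Qed.

Lemma ofR_nat n : ofR (INR n) = n%:R.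
Proof. rewrite INRE; exact: (rmorph_nat (real_complex R)). Qed.

Lemma ofR0 : ofR (IZR 0) = 0. Proof. exact: (ofR_nat 0). Qed.
Lemma ofR1 : ofR (IZR 1) = 1. Proof. exact: (ofR_nat 1). Qed.
Lemma ofR2 : ofR (IZR 2) = 2. Proof. exact: (ofR_nat 2). Qed.

Lemma ofRN1 : ofR (IZR (Zneg xH)) = -1.
Proof. by rewrite -ofR1 -ofRN. Qed.

Lemma ofR_inj : injective ofR.
Proof. by move=> x y []. Qed.

Lemma ofR_le x y : reflect (Rle x y) (ofR x <= ofR y).
Proof. rewrite [_ <= _]lecR; exact: RleP. Qed.

Lemma ofR_lt x y : reflect (Rlt x y) (ofR x < ofR y).
Proof. rewrite [_ < _]ltcR; exact: RltP. Qed.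

Lemma bernstein_ellipseP rho z : Rlt 0 rho -> bernstein_ellipse rho z ->
  exists2 u, ofC z = joukowski u & `|u| = ofR rho.
Proof.
move=> rho0 [theta ->]; set u := (_, _); exists (ofC u).
  by rewrite ofCM ofCD ofCV mulrC /joukowski ofC_real ofRV ofR2.
by rewrite norm_ofC Cmod_polar.
Qed.

Lemma ofC_jacobiP n al be z : ofC (jacobiP n al be z)
  = (2 ^+ n)^-1 * jacobi_sum n (fun k => ofR (jacobi_weight n al be k)) (ofC z).
Proof.
rewrite /jacobiP ofCM ofC_sum ofC_real ofRV ofRX ofR2; congr (_ * _).
apply: eq_bigr => k _; rewrite ofCM ofC_real !ofCM !ofCX !ofCD !ofC_real.
by rewrite ofR1 ofRN1.
Qed.

Lemma jacobi_weight_relP n al be :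
  jacobi_weight_rel n (ofR al) (ofR be) (fun k => ofR (jacobi_weight n al be k)).
Proof.
move=> k kn; have /= := jacobi_weightS (n - k.+1) k al be.
have -> : (k + (n - k.+1)).+1 = n by lia.
have -> : (n - k = (n - k.+1).+1)%N by lia.
by move=> /(congr1 ofR); rewrite !ofRM !ofRD -!ofR_nat.
Qed.

(** Reversing the weights exchanges [al] and [be]; the sign [(-1)^n] disappears in the modulus. *)
Lemma Cmod_jacobiP_opp n al be z :
  Cmod (jacobiP n al be (Copp z)) = Cmod (jacobiP n be al z).
Proof.
apply: ofR_inj; rewrite -!norm_ofC !ofC_jacobiP !normrM; congr (_ * _).
rewrite [ofC (Copp z)](_ : _ = - ofC z) // jacobi_sumN normrM normrX normrN1 expr1n mul1r.
congr `|_|; apply: eq_bigr => k _; congr (ofR _ * _).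
by rewrite /jacobi_weight !minusE subKn ?leq_ord // [RHS]Rmult_comm.
Qed.

(** * Maximum on the ellipse when [be <= al] *)

Section Maximum.
Variables (rho : R) (n : nat) (al be : R).
Hypotheses (rho_gt0 : Rlt 0 rho) (n_gt0 : (0 < n)%N).
Hypotheses (be_gtN1 : Rlt (-1) be) (al_ge_be : Rle be al) (al_be : Rle (-1) (Rplus al be)).

Let x0 := Rdiv (Rplus rho (Rinv rho)) 2.
Let b k := ofR (jacobi_weight n al be k).

Let b_gt0 k : (k <= n)%N -> 0 < b k.
Proof.
move=> /ssrnat.leP kn; rewrite -ofR0; apply/ofR_lt/jacobi_weight_gt0 => //.
exact: Rlt_le_trans al_ge_be.
Qed.

Let al_ge_be' : ofR be <= ofR al. Proof. exact/ofR_le. Qed.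
Let al_be' : -1 <= ofR al + ofR be. Proof. by rewrite -ofRN1 -ofRD; apply/ofR_le. Qed.
Let hb : jacobi_weight_rel n (ofR al) (ofR be) b. Proof. exact: jacobi_weight_relP. Qed.

Let two_n : 0 < (2 ^+ n)^-1 :> CC.
Proof. by rewrite invr_gt0 exprn_gt0 // ltr0n. Qed.

Let ofR_x0 : ofC (RtoC x0) = joukowski (ofR rho).
Proof. by rewrite ofC_real /x0 /Rdiv ofRM ofRD !ofRV ofR2. Qed.

Let norm_gt0 (u : CC) : `|u| = ofR rho -> u != 0.
Proof. by move=> e; rewrite -normr_gt0 e -ofR0; apply/ofR_lt. Qed.

Let norm_rho : `|ofR rho| = ofR rho.
Proof. by rewrite ger0_norm // -ofR0; apply/ofR_le/Rlt_le. Qed.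

Let Cmod_x0 : ofR (Cmod (jacobiP n al be (RtoC x0)))
  = (2 ^+ n)^-1 * jacobi_sum n b (joukowski (ofR rho)).
Proof.
rewrite -norm_ofC ofC_jacobiP ofR_x0 ger0_norm // mulr_ge0 //; first exact: ltW.
have := jacobi_sum_ge0 n_gt0 al_ge_be' al_be' b_gt0 hb (norm_gt0 norm_rho).
by rewrite norm_rho.
Qed.

(** The point [x0] corresponds to [u = rho > 0], where nonnegative coefficients make the value real
    and nonnegative. *)
Lemma jacobiP_x0 : jacobiP n al be (RtoC x0) = RtoC (Cmod (jacobiP n al be (RtoC x0))).
Proof. by apply: ofC_inj; rewrite ofC_real Cmod_x0 ofC_jacobiP ofR_x0. Qed.

Lemma Cmod_jacobiP_le z : bernstein_ellipse rho z ->
  Rle (Cmod (jacobiP n al be z)) (Cmod (jacobiP n al be (RtoC x0))).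
Proof.
move=> /(bernstein_ellipseP rho_gt0) [u zE uE]; apply/ofR_le.
rewrite Cmod_x0 -norm_ofC ofC_jacobiP zE normrM gtr0_norm // ler_pM2l // -uE.
exact: (norm_jacobi_sum_le n_gt0 al_ge_be' al_be' b_gt0 hb (norm_gt0 uE)).
Qed.

Let eq_norm z (u : CC) : ofC z = joukowski u -> `|u| = ofR rho ->
  Cmod (jacobiP n al be z) = Cmod (jacobiP n al be (RtoC x0)) ->
  `|jacobi_sum n b (joukowski u)| = jacobi_sum n b (joukowski `|u|).
Proof.
move=> zE uE /(congr1 ofR); rewrite Cmod_x0 -norm_ofC ofC_jacobiP zE normrM gtr0_norm // -uE.
by move=> /(mulfI (lt0r_neq0 two_n)).
Qed.

Lemma Cmod_jacobiP_eq z : Rlt be al -> bernstein_ellipse rho z ->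
  Cmod (jacobiP n al be z) = Cmod (jacobiP n al be (RtoC x0)) -> z = RtoC x0.
Proof.
move=> lt /(bernstein_ellipseP rho_gt0) [u zE uE] /(eq_norm zE uE) e.
apply: ofC_inj; rewrite ofR_x0 zE -uE; congr joukowski.
have lt' : ofR be < ofR al by apply/ofR_lt.
exact: (norm_jacobi_sum_eq1 n_gt0 al_ge_be' al_be' b_gt0 hb lt' (norm_gt0 uE) e).
Qed.

Lemma Cmod_jacobiP_eq_opp z : Rlt (-1) (Rplus al be) -> bernstein_ellipse rho z ->
  Cmod (jacobiP n al be z) = Cmod (jacobiP n al be (RtoC x0)) ->
  z = RtoC x0 \/ z = RtoC (Ropp x0).
Proof.
move=> lt /(bernstein_ellipseP rho_gt0) [u zE uE] /(eq_norm zE uE) e.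
have lt' : -1 < ofR al + ofR be by rewrite -ofRN1 -ofRD; apply/ofR_lt.
have [] := norm_jacobi_sum_eq2 n_gt0 al_ge_be' al_be' b_gt0 hb lt' (norm_gt0 uE) e.
  by rewrite uE => uR; left; apply: ofC_inj; rewrite ofR_x0 zE uR.
rewrite uE => uR; right; apply: ofC_inj.
by rewrite ofC_real ofRN -ofC_real ofR_x0 zE uR /joukowski invrN -opprD mulNr.
Qed.
End Maximum.
End Ellipse.

(** * Reduction of the three cases to [be <= al] *)

Theorem mainTheorem4 (rho : R) (n : nat) (al be : R)
  (hrho : 1 <= rho) (hn : (1 <= n)%nat) (hal : -1 < al) (hbe : -1 < be) :
  let x0 := (rho + / rho) / 2 in
  (* (i) *)
  ((al > be /\ al + be >= -1) ->
     jacobiP n al be (RtoC x0) = RtoC (Cmod (jacobiP n al be (RtoC x0))) /\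
     (forall z, bernstein_ellipse rho z ->
        Cmod (jacobiP n al be z) <= Cmod (jacobiP n al be (RtoC x0))) /\
     (forall z, bernstein_ellipse rho z ->
        Cmod (jacobiP n al be z) = Cmod (jacobiP n al be (RtoC x0)) ->
        z = RtoC x0)) /\
  (* (ii) *)
  ((al < be /\ al + be >= -1) ->
     (forall z, bernstein_ellipse rho z ->
        Cmod (jacobiP n al be z) <= Cmod (jacobiP n al be (RtoC (- x0)))) /\
     (forall z, bernstein_ellipse rho z ->
        Cmod (jacobiP n al be z) = Cmod (jacobiP n al be (RtoC (- x0))) ->
        z = RtoC (- x0))) /\
  (* (iii) *)
  ((al = be /\ al >= - / 2) ->
     (forall z, bernstein_ellipse rho z ->
        Cmod (jacobiP n al be z) <= Cmod (jacobiP n al be (RtoC x0))) /\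
     Cmod (jacobiP n al be (RtoC (- x0))) = Cmod (jacobiP n al be (RtoC x0)) /\
     (al > - / 2 ->
        forall z, bernstein_ellipse rho z ->
        Cmod (jacobiP n al be z) = Cmod (jacobiP n al be (RtoC x0)) ->
        z = RtoC x0 \/ z = RtoC (- x0))).

Proof.
intro x0; assert (rho_gt0 : 0 < rho) by lra.
assert (n_gt0 : is_true (ssrnat.leq 1 n)) by (destruct n; [inversion hn | reflexivity]).
split; [|split].
- intros [lt ge]; split; [|split].
  + apply Ellipse.jacobiP_x0; trivial; lra.
  + intros z hz; apply Ellipse.Cmod_jacobiP_le; trivial; lra.
  + intros z hz; apply Ellipse.Cmod_jacobiP_eq; trivial; lra.
- intros [lt ge].
  (* Reflection turns the values at [z] and [- x0] into values at [- z] and [x0] with the parameters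
     exchanged, as in (i). *)
  split; intros z hz; rewrite <- (CoppK z), <- Copp_RtoC,
    (Ellipse.Cmod_jacobiP_opp n al be (Copp z)), (Ellipse.Cmod_jacobiP_opp n al be (RtoC x0)).
  + apply Ellipse.Cmod_jacobiP_le; trivial; try lra.
    apply bernstein_ellipse_opp; exact hz.
  + intro e; f_equal; revert e; apply Ellipse.Cmod_jacobiP_eq; trivial; try lra.
    apply bernstein_ellipse_opp; exact hz.
(* Here [d = 0], so uniqueness uses the coefficient of index 2, and [al > - / 2] says [s > 0].
   Reflection fixes the parameters, hence equal moduli at both endpoints. *)
- intros [<- ge]; split; [|split].
  + intros z hz; apply Ellipse.Cmod_jacobiP_le; trivial; lra.
  + rewrite <- Copp_RtoC; apply Ellipse.Cmod_jacobiP_opp.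
  + intros gt z hz; apply Ellipse.Cmod_jacobiP_eq_opp; trivial; lra.
Qed.
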